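(* In the group $G_{\operatorname{NAP}}$, let $\mathtt{C}=\sum_{n\geq0}c_n$ be the sum of all corollas, where $c_n$ is the rooted tree consisting of a root with $n$ leaves, and let $\mathtt{L}=\sum_{n\geq0}(-1)^n\ell_n$, where $\ell_n$ is the linear rooted tree (path rooted at an end) with $n+1$ vertices. Then $\mathtt{C}=\mathtt{L}^{-1}$.
   Context: $\operatorname{NAP}(I)$ is the set of rooted trees on vertex set $I$; the composition $t\circ(s_i)_{i\in I}$, for $t\in\operatorname{NAP}(I)$ and $s_i\in\operatorname{NAP}(J_i)$, is the rooted tree on $\coprod_iJ_i$ obtained from the disjoint union of the $s_i$ by adding, for each edge $i$–$i'$ of $t$, an edge between the roots of $s_i$ and $s_{i'}$; its root is the root of $s_k$, $k$ being the root of $t$. $G_{\operatorname{NAP}}$ is the group of formal series $\sum_t a_t\,t$ over unlabeled rooted trees $t$ with rational coefficients and coefficient $1$ on the one-vertex tree, with product $\alpha\times\beta=\sum_{m\geq1}\sum_{n_1,\dots,n_m\geq1}\langle x_m\circ(y_{n_1},\dots,y_{n_m})\rangle$, where $x_m$ (resp. $y_n$) is a labelled representative (linear combination of rooted trees on $\{1,\dots,m\}$, resp. $\{1,\dots,n\}$) of the part of $\alpha$ (resp. $\beta$) with $m$ (resp. $n$) vertices, composition is extended multilinearly, and $\langle\cdot\rangle$ forgets labels. The identity is the one-vertex tree. *)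

(* Defs.v *)
From mathcomp Require Import all_boot all_order all_algebra perm.
Set Implicit Arguments. Unset Strict Implicit. Unset Printing Implicit Defensive.
Import GRing.Theory Num.Theory.
Local Open Scope ring_scope.

(* A labelled rooted tree on the vertex set 'I_n is encoded by its parent
   function p : the root r is the unique fixed point and every vertex reaches
   r by iterating p (so the edges {v, p v}, v <> r, form a tree). *)
Definition ltree (n : nat) := {ffun 'I_n -> 'I_n}.

Definition is_rtree n (p : ltree n) : bool :=
  [exists r : 'I_n, (p r == r) && [forall v : 'I_n, iter n (fun x => p x) v == r]].

Definition liso n (p q : ltree n) : bool :=
  [exists s : 'S_n, [forall v : 'I_n, q (s v) == s (p v)]].

Definition ncls n (p : ltree n) : nat := #|[pred q : ltree n | liso p q]|.

(* A formal series over unlabelled rooted trees is represented by its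
   coefficient function on labelled trees (meant to be relabelling-invariant;
   only values on rooted trees matter). *)
Definition series := forall n : nat, ltree n -> rat.

(* Composition t o (s_i)_i, with t on 'I_m and s_i on 'I_(n i); its vertex set
   is the disjoint union {i : 'I_m & 'I_(n i)}.  comp_rel x y : y is the parent
   of x in the composite (or y = x if x is the root). *)
Section Comp.
Variables (m : nat) (n : 'I_m -> nat) (t : ltree m) (s : forall i, ltree (n i)).

Definition vtx := {i : 'I_m & 'I_(n i)}.

Definition comp_rel (x y : vtx) : bool :=
  if s (tag x) (tagged x) != tagged x
  then y == Tagged (fun i => 'I_(n i)) (s (tag x) (tagged x))
  else if t (tag x) != tag x
  then (tag y == t (tag x)) && (s (tag y) (tagged y) == tagged y)
  else y == x.

Definition comp_iso N (T : ltree N) : bool :=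
  [exists f : {ffun 'I_N -> vtx},
     injectiveb f && [forall v : 'I_N, comp_rel (f v) (f (T v))]].
End Comp.

(* The product alpha x beta = sum_m sum_{n_1..n_m} < x_m o (y_{n_1},...,y_{n_m}) >,
   with the labelled representative x_m := sum_{t on 'I_m} a(t)/ncls(t) t
   (each unlabelled tree is represented by the average of its labellings).
   Coefficient of the unlabelled class of T (T on 'I_N): *)
Definition nap_mul (a b : series) : series := fun N (T : ltree N) =>
  if ~~ is_rtree T then 0 else
  \sum_(m < N.+1) \sum_(t : ltree m | is_rtree t)
    \sum_(n : {ffun 'I_m -> 'I_N.+1} |
            [forall i, (0 < n i)%N] && ((\sum_i (n i : nat))%N == N))
    \sum_(s : {dffun forall i : 'I_m, ltree (n i)} | [forall i, is_rtree (s i)])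
      (a m t / (ncls t)%:R) *
      (\prod_i (b (n i) (s i) / (ncls (s i))%:R)) *
      (comp_iso t s T)%:R.

Definition one_series : series := fun N T =>
  if is_rtree T && (N == 1)%N then 1 else 0.

Definition is_corolla n (p : ltree n) : bool :=
  [exists r : 'I_n, [forall v : 'I_n, p v == r]].

Definition is_linear n (p : ltree n) : bool :=
  [forall u : 'I_n, forall v : 'I_n,
     (p u == p v) ==> [|| u == v, p u == u | p v == v]].

Definition Cser : series := fun N T =>
  if is_rtree T && is_corolla T then 1 else 0.

Definition Lser : series := fun N T =>
  if is_rtree T && is_linear T then (-1) ^+ N.-1 else 0.

Arguments nap_mul a b n p : clear implicits.
Arguments one_series n p : clear implicits.
Arguments Cser n p : clear implicits.
Arguments Lser n p : clear implicits.

(* Main.v *)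
Require Import Defs.
From mathcomp Require Import all_boot all_order all_algebra.
From mathcomp Require Import perm zify.

(* Since c_n and l_n are the only trees involved, averaging over labellings
   lets one replace each of them by a standard labelling, so either product is
   a sum over compositions n = (n_0, ..., n_{m-1}) of N of terms equal, up to a
   sign that does not depend on n, to (-1)^m [T is the composite given by n].
   Number the path so that its leaf is vertex 0 and the corolla so that its
   root is vertex 0.  Then in both products (1, a+1, n_2, ...) and
   (a+2, n_2, ...) give isomorphic composites and have opposite signs: all
   terms cancel, except for the composition (1) of N = 1. *)

Set Implicit Arguments. Unset Strict Implicit. Unset Printing Implicit Defensive.
Import GRing.Theory Num.Theory.
Local Open Scope ring_scope.

(** * Isomorphism of labelled rooted trees *)

Lemma lisoP n (p q : ltree n) :
  reflect (exists s : 'S_n, forall v, q (s v) = s (p v)) (liso p q).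
Proof.
apply: (iffP existsP) => -[s Hs]; exists s.
  by move=> v; apply/eqP; move/forallP: Hs.
by apply/forallP => v; rewrite Hs.
Qed.

Lemma liso_refl n (p : ltree n) : liso p p.
Proof. by apply/lisoP; exists 1%g => v; rewrite !perm1. Qed.

Lemma liso_sym n (p q : ltree n) : liso p q -> liso q p.
Proof.
case/lisoP=> s Hs; apply/lisoP; exists (s^-1)%g => v.
by apply: (canRL (permK s)); rewrite -Hs permKV.
Qed.

Lemma liso_trans n (p q r : ltree n) : liso p q -> liso q r -> liso p r.
Proof.
case/lisoP=> s Hs /lisoP[s' Hs']; apply/lisoP; exists (s * s')%g => v.
by rewrite !permM Hs' Hs.
Qed.

Lemma ncls_liso n (p q : ltree n) : liso p q -> ncls p = ncls q.
Proof.
move=> pq; apply: eq_card => r; rewrite !inE; apply/idP/idP.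
  by apply: liso_trans; apply: liso_sym.
exact: liso_trans.
Qed.

Lemma ncls_gt0 n (p : ltree n) : (0 < ncls p)%N.
Proof. by apply/card_gt0P; exists p; rewrite inE liso_refl. Qed.

Lemma is_rtree_liso n (p q : ltree n) : liso p q -> is_rtree p -> is_rtree q.
Proof.
case/lisoP=> s Hs /existsP[r /andP[/eqP Hr /forallP Hi]].
apply/existsP; exists (s r); rewrite Hs Hr eqxx /=.
apply/forallP => v; rewrite -[v](permKV s); set u := (s^-1)%g v.
rewrite -(eqP (Hi u)).
have E k : iter k (fun x => q x) (s u) = s (iter k (fun x => p x) u).
  by elim: k => //= k ->; rewrite Hs.
by rewrite E.
Qed.

(** * Invariance of composites under relabelling *)

Lemma comp_iso_morph m n t s m' n' t' s' N (T : ltree N)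
    (phi : @vtx m n -> @vtx m' n') :
  injective phi ->
  (forall x y, comp_rel t s x y -> comp_rel t' s' (phi x) (phi y)) ->
  comp_iso t s T -> comp_iso t' s' T.
Proof.
move=> phi_inj phi_rel /existsP[f /andP[/injectiveP f_inj /forallP f_rel]].
apply/existsP; exists [ffun v => phi (f v)]; apply/andP; split.
  by apply/injectiveP => u v; rewrite !ffunE => /phi_inj /f_inj.
by apply/forallP => v; rewrite !ffunE; apply: phi_rel.
Qed.

Lemma comp_iso_liso_r m (n : 'I_m -> nat) t (s s' : forall i, ltree (n i))
    N (T : ltree N) :
  (forall i, liso (s i) (s' i)) -> comp_iso t s T -> comp_iso t s' T.
Proof.
move=> H.
have /fin_all_exists[g Hg] : forall i, exists g : 'S_(n i),
  forall v, s' i (g v) = g (s i v) by move=> i; apply/lisoP.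
pose phi (x : vtx n) : vtx n := Tagged (fun i => 'I_(n i)) (g (tag x) (tagged x)).
have phi_inj : injective phi.
  move=> [i j] [i' j'] /eqP; rewrite -tag_eqE => /andP[/= /eqP E].
  by subst i'; rewrite tagged_asE => /eqP /perm_inj ->.
apply: (comp_iso_morph phi_inj) => -[i j] y.
rewrite /comp_rel /= Hg !(inj_eq perm_inj).
case: ifP => _; first by move=> /eqP ->.
case: ifP => _; last by move=> /eqP ->.
by case: y => i' j' /=; rewrite Hg (inj_eq perm_inj).
Qed.

(* With junk value [i] when [P i >= n]: thus [P = S] gives the path rooted at
   [n.-1] and [P = fun=> 0] gives the corolla rooted at [0]. *)
Definition ptree (P : nat -> nat) n : ltree n := [ffun i : 'I_n => insubd i (P i)].

Lemma val_ptree P n (i : 'I_n) :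
  ptree P n i = (if P i < n then P i else i)%N :> nat.
Proof. by rewrite ffunE val_insubd. Qed.

(** Relabelling the outer tree by [g] moves each branch along with its vertex. The branches have a
    standard form fixed by their size, so only the sizes have to be permuted. *)
Lemma comp_iso_perm m (n n' : 'I_m -> nat) (t t' : ltree m) (g : 'S_m) P
    N (T : ltree N) :
  (forall i, t' (g i) = g (t i)) -> (forall i, n i = n' (g i)) ->
  comp_iso t (fun i => ptree P (n i)) T ->
  comp_iso t' (fun i => ptree P (n' i)) T.
Proof.
move=> tg ng.
pose phi (x : vtx n) : vtx n' :=
  Tagged (fun i => 'I_(n' i)) (cast_ord (ng (tag x)) (tagged x)).
have Pc i (j : 'I_(n i)) :
    ptree P (n' (g i)) (cast_ord (ng i) j) = cast_ord (ng i) (ptree P (n i) j).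
  by apply: val_inj; rewrite /= !val_ptree /= -ng.
have phi_inj : injective phi.
  move=> [i j] [i' j'] /eqP; rewrite -tag_eqE => /andP[/= /eqP /perm_inj E].
  by subst i'; rewrite tagged_asE => /eqP /cast_ord_inj ->.
apply: (comp_iso_morph phi_inj) => -[i j] y.
rewrite /comp_rel /= Pc tg !(inj_eq perm_inj) (inj_eq (@cast_ord_inj _ _ _)).
case: ifP => _; first by move=> /eqP ->.
case: ifP => _; last by move=> /eqP ->.
by case: y => i' j' /=; rewrite Pc.
Qed.

(** * Averaging over labellings *)

Lemma sum_liso_class n (c : ltree n) (w : rat) (F : ltree n -> rat) :
  is_rtree c -> (forall t, liso c t -> F t = F c) ->
  \sum_(t | is_rtree t) (if liso c t then w else 0) / (ncls t)%:R * F t = w * F c.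
Proof.
move=> cr HF.
rewrite (bigID (liso c)) /= [X in _ + X]big1 ?addr0; last first.
  by move=> t /andP[_ /negPf ->]; rewrite !mul0r.
rewrite (eq_bigl (liso c)); last first.
  by move=> t /=; case H: (liso c t); rewrite ?andbF // (is_rtree_liso H cr).
(* The class of [c] has [ncls c] members, all of weight [w / ncls c]. *)
rewrite (eq_bigr (fun=> w / (ncls c)%:R * F c)); last first.
  by move=> t H; rewrite H HF // (ncls_liso H).
rewrite sumr_const -[LHS]mulr_natr mulrAC divfK //.
by rewrite pnatr_eq0 -lt0n ncls_gt0.
Qed.

(** The same averaging done in all blocks at once: the families blockwise isomorphic to the standard
    one number the product of the class sizes, which cancels the denominators. *)
Lemma sum_branches m (n : 'I_m -> nat) (t : ltree m) N (T : ltree N) P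
    (b : series) (w : nat -> rat) (A : rat) :
  (forall k, (0 < k)%N -> is_rtree (ptree P k)) ->
  (forall k (q : ltree k), (0 < k)%N ->
     b k q = if liso (ptree P k) q then w k else 0) ->
  (forall i, 0 < n i)%N ->
  \sum_(s : {dffun forall i : 'I_m, ltree (n i)} | [forall i, is_rtree (s i)])
     A * (\prod_i (b (n i) (s i) / (ncls (s i))%:R)) * (comp_iso t s T)%:R =
  A * (\prod_i w (n i)) * (comp_iso t (fun i => ptree P (n i)) T)%:R.
Proof.
move=> Pr bE n0.
pose c := fun i => ptree P (n i).
pose D := [pred s : {dffun forall i : 'I_m, ltree (n i)} | [forall i, liso (c i) (s i)]].
have cardD : #|D| = (\prod_i ncls (c i))%N.
  pose F i : pred (ltree (n i)) := [pred q | liso (c i) q].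
  transitivity #|(family F : simpl_pred {dffun forall i : 'I_m, ltree (n i)})|.
    by apply: eq_card.
  by rewrite card_family foldrE big_map big_enum.
rewrite (bigID (mem D)) /= [X in _ + X]big1 ?addr0; last first.
  move=> s /andP[_]; rewrite negb_forall => /existsP[i Hi].
  by rewrite (bigD1 i) //= bE // (negPf Hi) !mul0r mulr0 mul0r.
rewrite (eq_bigl (mem D)); last first.
  move=> s /=; case H: (s \in D); rewrite ?andbF ?andbT //.
   apply/forallP => i; apply: (@is_rtree_liso _ (c i)); last exact: Pr.
  exact: (forallP H).
rewrite (eq_bigr (fun=> A * (\prod_i (w (n i) / (ncls (c i))%:R)) *
   (comp_iso t c T)%:R)); last first.
  move=> s /forallP H; congr (_ * _ * _).
    by apply: eq_bigr => i _; rewrite bE // H (ncls_liso (H i)).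
  congr (nat_of_bool _)%:R; apply/idP/idP; apply: comp_iso_liso_r => i //.
  exact: liso_sym.
rewrite sumr_const cardD -[LHS]mulr_natr natr_prod.
rewrite -!mulrA; congr (_ * _).
rewrite mulrCA mulrC; congr (_ * _).
rewrite -big_split /=; apply: eq_bigr => i _.
by rewrite divfK // pnatr_eq0 -lt0n ncls_gt0.
Qed.

Definition composition m N (n : {ffun 'I_m -> 'I_N.+1}) : bool :=
  [forall i, (0 < n i)%N] && ((\sum_i (n i : nat))%N == N).

(** The averages are removed in two stages: over the branches with [t] and [n] fixed, then over
    [t]. *)
Lemma nap_mul_ptree P' P a b (wa wb : nat -> rat) N (T : ltree N) :
  is_rtree T ->
  (forall k, (0 < k)%N -> is_rtree (ptree P' k)) ->
  (forall k, (0 < k)%N -> is_rtree (ptree P k)) ->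
  (forall k (q : ltree k), (0 < k)%N ->
     a k q = if liso (ptree P' k) q then wa k else 0) ->
  (forall k (q : ltree k), (0 < k)%N ->
     b k q = if liso (ptree P k) q then wb k else 0) ->
  nap_mul a b N T =
  \sum_(m < N.+1) wa m * \sum_(n : {ffun 'I_m -> 'I_N.+1} | composition n)
    (\prod_i wb (n i)) *
    (comp_iso (ptree P' m) (fun i => ptree P (n i)) T)%:R.
Proof.
move=> Tr P'r Pr aE bE; rewrite /nap_mul Tr /=.
apply: eq_bigr => -[[|m] mN] _ /=.
  rewrite [RHS](_ : _ = 0); last first.
    rewrite big_pred0 ?mulr0 // => n; rewrite /composition big_ord0 andbC.
    case/existsP: Tr => -[r rN] _; suff -> : (0 == N)%N = false by [].
    by apply/negbTE; rewrite eq_sym -lt0n (leq_ltn_trans _ rN).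
  by rewrite big1 // => t /existsP[[]].
set c := ptree P' m.+1.
pose F t := \sum_(n : {ffun 'I_m.+1 -> 'I_N.+1} | composition n)
  (\prod_i wb (n i)) * (comp_iso t (fun i => ptree P (n i)) T)%:R.
transitivity (\sum_(t | is_rtree t)
    (if liso c t then wa m.+1 else 0) / (ncls t)%:R * F t).
  apply: eq_bigr => t _; rewrite -aE // mulr_sumr.
  apply: eq_bigr => n /andP[/forallP n0 _].
  by rewrite (@sum_branches _ (fun i => n i) _ _ _ P _ wb) // mulrA.
apply: sum_liso_class => [|t /lisoP[g Hg]]; first exact: P'r.
(* A single composition gives a term that depends on the labelling of [t]; the sum over all of them
   does not, since [g] permutes the compositions of [N]. *)
rewrite /F [RHS](reindex (fun n : {ffun 'I_m.+1 -> 'I_N.+1} => [ffun i => n (g i)])).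
  apply: eq_big => [n|n _].
    rewrite /composition; congr (_ && _).
      apply/forallP/forallP => H i; first by rewrite ffunE.
      by rewrite -[i](permKV g); have := H (g^-1 i)%g; rewrite ffunE.
    rewrite (reindex_inj (@perm_inj _ g)) /=; congr (_ == N).
    by apply: eq_bigr => i _; rewrite ffunE.
  congr (_ * (nat_of_bool _)%:R).
    rewrite (reindex_inj (@perm_inj _ g)) /=.
    by apply: eq_bigr => i _; rewrite ffunE.
  apply/idP/idP; last first.
    by apply: (comp_iso_perm Hg) => i; rewrite ffunE.
  apply: (@comp_iso_perm _ _ _ _ _ g^-1%g) => i; last by rewrite ffunE permKV.
  by apply: (canRL (permK g)); rewrite -Hg permKV.
exists (fun n : {ffun 'I_m.+1 -> 'I_N.+1} => [ffun i => n (g^-1 i)%g]) => n _; apply/ffunP => i;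
  by rewrite !ffunE ?permK ?permKV.
Qed.

(* [comp_rel] for [ptree P' m] and [ptree P (n i)], with the vertex set
   {i : 'I_m & 'I_(n i)} embedded in [nat * nat] to avoid dependent types. *)
Definition prel (P' P : nat -> nat) m (n : nat -> nat) (x y : nat * nat) : bool :=
  let par Q k j := (if Q j < k then Q j else j)%N in
  if par P (n x.1) x.2 != x.2 then y == (x.1, par P (n x.1) x.2)
  else if par P' m x.1 != x.1
  then (y.1 == par P' m x.1) && (par P (n y.1) y.2 == y.2)
  else y == x.

Definition pvtx m (n : nat -> nat) (x : nat * nat) := ((x.1 < m) && (x.2 < n x.1))%N.

(** [n'] extends the sizes to all naturals; [pvtx] confines the vertices to genuine blocks,
    replacing the bounds carried by the dependent type. *)
Lemma comp_iso_ptreeP P' P m (n : 'I_m -> nat) (n' : nat -> nat) N (T : ltree N) :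
  (forall i, n i = n' i) ->
  comp_iso (ptree P' m) (fun i => ptree P (n i)) T <->
  exists f : 'I_N -> nat * nat, [/\ injective f, forall v, pvtx m n' (f v) &
    forall v, prel P' P m n' (f v) (f (T v))].
Proof.
move=> nn'.
pose e (x : vtx n) := (tag x : nat, tagged x : nat).
have e_inj : injective e.
  move=> [i j] [i' j'] [/val_inj E].
  by subst i' => /val_inj /= ->.
have relE x y : comp_rel (ptree P' m) (fun i => ptree P (n i)) x y =
    prel P' P m n' (e x) (e y).
  rewrite /prel /comp_rel -!(inj_eq e_inj) /e /= -!nn' -!(inj_eq val_inj) /=.
  by rewrite !val_ptree.
split=> [/existsP[f /andP[/injectiveP f_inj /forallP f_rel]]|[f [f_inj fV f_rel]]].
  exists (fun v => e (f v)); split=> [u v /e_inj /f_inj //|v|v].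
    by rewrite /pvtx /= -nn' !ltn_ord.
  by rewrite -relE.
have fV1 v : ((f v).1 < m)%N by case/andP: (fV v).
have fV2 v : ((f v).2 < n (Ordinal (fV1 v)))%N by case/andP: (fV v); rewrite nn'.
pose g v : vtx n := Tagged (fun i => 'I_(n i)) (Ordinal (fV2 v)).
have eg v : e (g v) = f v by rewrite /e /=; case: (f v).
apply/existsP; exists (finfun g); apply/andP; split.
  by apply/injectiveP => u v; rewrite !ffunE => /(congr1 e); rewrite !eg => /f_inj.
by apply/forallP => v; rewrite !ffunE relE !eg.
Qed.

(* The isomorphism from the composite of (1, n 1, n 2, ...) to that of
   (n 1 + 1, n 2, ...): the single vertex of block 0 becomes the last vertex of
   the enlarged block. *)
Definition merge_vtx (n : nat -> nat) (x : nat * nat) : nat * nat :=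
  if x.1 is i.+1 then (i, x.2) else (0%N, n 1%N).

Definition split_vtx (n : nat -> nat) (x : nat * nat) : nat * nat :=
  if (x.1 == 0)%N && (x.2 == n 1%N) then (0%N, 0%N) else (x.1.+1, x.2).

Definition merged (n : nat -> nat) (k : nat) : nat :=
  if k is k'.+1 then n k'.+2 else (n 1%N).+1.

(** The only property of the two shapes that the cancellation uses: [merge_vtx] respects the parent
    relations. *)
Definition prel_mergeable P' P := forall m n x y,
  n 0%N = 1%N -> (0 < n 1%N)%N -> pvtx m.+2 n x -> pvtx m.+2 n y ->
  prel P' P m.+1 (merged n) (merge_vtx n x) (merge_vtx n y) = prel P' P m.+2 n x y.


(** Splitting innermost conditions first keeps the hypotheses free of conditionals, as [lia]
    requires. *)
Ltac case_inner_ifs := repeat match goal with |- context [if ?b then _ else _] =>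
  lazymatch b with context [if _ then _ else _] => fail | _ => case: (boolP b) => ? end end.

(** Block 0 is the leaf end of the path: its single vertex hangs from the root of block 1, hence is
    one more leaf of that corolla. *)
Lemma prel_merge_path_corollas : prel_mergeable S (fun=> 0%N).
Proof.
move=> m n [[|[|i]] j] [[|[|i']] j'] n0 n1;
  rewrite /prel /pvtx /merge_vtx /merged /= ?n0 !xpair_eqE ?eqxx; case_inner_ifs; lia.
Qed.

(** Block 0 is now the root of the composite: placed above the path of block 1, it lengthens that
    path by one vertex, and the other paths hang from this new root. *)
Lemma prel_merge_corolla_paths : prel_mergeable (fun=> 0%N) S.
Proof.
move=> m n [[|[|i]] j] [[|[|i']] j'] n0 n1; 
  rewrite /prel /pvtx /merge_vtx /merged /= ?n0 !xpair_eqE ?eqxx; case_inner_ifs; lia.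
Qed.

(** * Corollas and linear trees as isomorphism classes of standard trees *)

Lemma ptree_corollaE k (i : 'I_k.+1) : ptree (fun=> 0%N) k.+1 i = ord0.
Proof. by apply: val_inj; rewrite /= val_ptree. Qed.

Lemma is_rtree_corolla k : (0 < k)%N -> is_rtree (ptree (fun=> 0%N) k).
Proof.
case: k => // k _; apply/existsP; exists ord0; rewrite ptree_corollaE eqxx /=.
by apply/forallP => v; rewrite ptree_corollaE.
Qed.

Lemma Cser_liso k (q : ltree k) : (0 < k)%N ->
  Cser k q = if liso (ptree (fun=> 0%N) k) q then 1 else 0.
Proof.
case: k q => // k q _; rewrite /Cser; congr (if _ then _ else _); apply/idP/idP.
  case/andP=> _ /existsP[r /forallP qr]; apply/lisoP; exists (tperm ord0 r) => v.
  by rewrite ptree_corollaE tpermL (eqP (qr _)).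
move=> cq; rewrite (is_rtree_liso cq) ?is_rtree_corolla //=.
case/lisoP: cq => s Hs; apply/existsP; exists (s ord0); apply/forallP => v.
by rewrite -[v](permKV s) Hs ptree_corollaE.
Qed.

Lemma val_iter_path k (i : 'I_k.+1) j :
  iter j (fun x => ptree S k.+1 x) i = minn (i + j) k :> nat.
Proof.
elim: j => [|j IHj] /=; first by have := ltn_ord i; lia.
by rewrite val_ptree IHj; case: ifP; lia.
Qed.

Lemma is_rtree_path k : (0 < k)%N -> is_rtree (ptree S k).
Proof.
case: k => // k _; apply/existsP; exists ord_max; apply/andP; split.
  by apply/eqP/val_inj; rewrite /= val_ptree /= ltnn.
by apply/forallP => v; apply/eqP/ord_inj; rewrite val_iter_path /=; lia.
Qed.

(* In a linear tree the depth is an injective function with values below the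
   number of vertices, so it numbers the vertices along the path. *)
Lemma linear_liso_path k (q : ltree k) :
  is_rtree q -> is_linear q -> liso (ptree S k) q.
Proof.
case: k q => [|k] q; first by case/existsP=> -[].
case/existsP=> r /andP[/eqP qr /forallP qiter] /forallP qlin.
have ex v : exists j, iter j (fun x => q x) v == r by exists k.+1; apply: qiter.
pose d v := ex_minn (ex v).
have dP v : iter (d v) (fun x => q x) v = r by rewrite /d; case: ex_minnP => j /eqP.
have d_min v j : iter j (fun x => q x) v = r -> (d v <= j)%N.
  by rewrite /d; case: ex_minnP => l _ H /eqP; apply: H.
have d0 v : d v = 0%N -> v = r by move=> E; have := dP v; rewrite E.
have dr : d r = 0%N by apply/eqP; rewrite -leqn0; apply: d_min.
have dS v : v != r -> d v = (d (q v)).+1.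
  move=> vr; apply/eqP; rewrite eqn_leq; apply/andP; split.
    by apply: d_min; rewrite iterSr dP.
  case E: (d v) => [|j]; first by rewrite (d0 _ E) eqxx in vr.
  by rewrite ltnS; apply: d_min; rewrite -iterSr -E dP.
have fixr v : q v = v -> v = r.
  by move=> E; rewrite -(dP v); elim: (d v) => //= j <-.
(* By induction on the common depth: two vertices of equal positive depth have the same parent, and
   linearity then identifies them. *)
have d_inj : injective d.
  move=> u v; move Ej: (d v) => j; elim: j u v Ej => [|j IHj] u v dv du.
    by rewrite (d0 _ du) (d0 _ dv).
  have ur : u != r by apply/eqP => E; rewrite E dr in du.
  have vr : v != r by apply/eqP => E; rewrite E dr in dv.
  have quv : q u = q v.
    by apply: IHj; apply: succn_inj; rewrite -dS.
  have /forallP/(_ v) := qlin u; rewrite quv eqxx /= -{1}quv.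
  by case/or3P => /eqP // /fixr E; [rewrite E eqxx in ur | rewrite E eqxx in vr].
have d_iter v j : (j <= d v)%N -> d (iter j (fun x => q x) v) = (d v - j)%N.
  elim: j => [|j IHj] jd; first by rewrite subn0.
  have E := IHj (ltnW jd); rewrite /=.
  have : iter j (fun x => q x) v != r.
    by apply/eqP => F; rewrite F dr in E; lia.
  by move/dS; rewrite E subnS => ->.
have d_lt v : (d v < k.+1)%N.
  rewrite ltnNge; apply/negP => kd.
  (* A depth above [k] would give [k + 2] ancestors of distinct depths among [k + 1] vertices. *)
  have f_inj : injective (fun j : 'I_k.+2 => iter j (fun x => q x) v).
    move=> i j /(congr1 d).
    have := ltn_ord i; have := ltn_ord j => *; apply: ord_inj.
    by move: (d_iter v i) (d_iter v j); lia.
  by have := leq_card _ f_inj; rewrite !card_ord ltnn.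
(* Depth is reversed because the standard path has its root at the last vertex. *)
pose g v : 'I_k.+1 := inord (k - d v).
have gE v : g v = (k - d v)%N :> nat by rewrite inordK // ltnS leq_subr.
have g_inj : injective g.
  move=> u v /(congr1 val); rewrite /= !gE => E; apply: d_inj.
  by have := d_lt u; have := d_lt v; lia.
apply/liso_sym/lisoP; exists (perm g_inj) => v; rewrite !permE.
apply: ord_inj; rewrite val_ptree !gE.
have := d_lt v; have [->|/dS ->] := eqVneq v r; first by rewrite qr dr; case: ifP; lia.
by case: ifP; lia.
Qed.

Lemma Lser_liso k (q : ltree k) : (0 < k)%N ->
  Lser k q = if liso (ptree S k) q then (-1) ^+ k.-1 else 0.
Proof.
move=> k0; rewrite /Lser; congr (if _ then _ else _); apply/idP/idP.
  by case/andP; apply: linear_liso_path.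
move=> cq; rewrite (is_rtree_liso cq) ?is_rtree_path //=.
case/lisoP: cq => s Hs; apply/forallP => u; apply/forallP => v.
rewrite -[u](permKV s) -[v](permKV s) !Hs !(inj_eq (@perm_inj _ s)); apply/implyP => /eqP.
move/(congr1 (@nat_of_ord _)); rewrite -!(inj_eq (@ord_inj _)) !val_ptree.
by do 2!case: ifP; lia.
Qed.

(** * Merging the first two blocks of a composite *)

Lemma merge_vtxK m n x : n 0%N = 1%N -> pvtx m.+2 n x -> split_vtx n (merge_vtx n x) = x.
Proof.
move=> n0; case: x => -[|[|i]] j; rewrite /pvtx /merge_vtx /split_vtx /= ?n0.
- by rewrite eqxx; case: j.
- by case: eqP => // ->; rewrite ltnn.
- by [].
Qed.

Lemma pvtx_merge_vtx m n x : pvtx m.+2 n x -> pvtx m.+1 (merged n) (merge_vtx n x).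
Proof. by case: x => -[|[|i]] j; rewrite /pvtx /merge_vtx /merged /=; lia. Qed.

Lemma pvtx_split_vtx m n x :
  n 0%N = 1%N -> pvtx m.+1 (merged n) x -> pvtx m.+2 n (split_vtx n x).
Proof.
move=> n0; case: x => -[|i] j; rewrite /pvtx /split_vtx /merged /=; last by lia.
by case: eqP => E; rewrite /= ?n0 //; lia.
Qed.

Lemma split_vtxK n x : merge_vtx n (split_vtx n x) = x.
Proof.
case: x => i j; rewrite /merge_vtx /split_vtx /=.
by case: ifP => // /andP[/eqP -> /eqP ->].
Qed.

Lemma comp_iso_merge P' P m (n : 'I_m.+2 -> nat) (n2 : 'I_m.+1 -> nat)
    (n' : nat -> nat) N (T : ltree N) :
  prel_mergeable P' P -> n' 0%N = 1%N -> (0 < n' 1%N)%N ->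
  (forall i, n i = n' i) -> (forall i, n2 i = merged n' i) ->
  comp_iso (ptree P' m.+1) (fun i => ptree P (n2 i)) T =
  comp_iso (ptree P' m.+2) (fun i => ptree P (n i)) T.
Proof.
move=> H n0 n1 nE n2E; apply/idP/idP.
  move/(comp_iso_ptreeP _ _ _ n2E) => [f [f_inj fV f_rel]].
  apply/(comp_iso_ptreeP _ _ _ nE); exists (fun v => split_vtx n' (f v)).
  split=> [u v /(congr1 (merge_vtx n'))|v|v]; first by rewrite !split_vtxK => /f_inj.
    exact: pvtx_split_vtx.
  by rewrite -H ?split_vtxK //; apply: pvtx_split_vtx.
move/(comp_iso_ptreeP _ _ _ nE) => [f [f_inj fV f_rel]].
apply/(comp_iso_ptreeP _ _ _ n2E); exists (fun v => merge_vtx n' (f v)).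
split=> [u v /(congr1 (split_vtx n'))|v|v].
- by rewrite !(merge_vtxK n0 (fV _)) => /f_inj.
- exact: pvtx_merge_vtx.
- by rewrite H.
Qed.

(** * Merging the first two parts of a composition *)

Definition merge_first m N (n : {ffun 'I_m.+2 -> 'I_N.+1}) : {ffun 'I_m.+1 -> 'I_N.+1} :=
  [ffun i => if unlift ord0 i is Some j then n (lift ord0 i)
             else inord (n (lift ord0 ord0)).+1].

Definition split_first m N (n : {ffun 'I_m.+1 -> 'I_N.+1}) : {ffun 'I_m.+2 -> 'I_N.+1} :=
  [ffun i => if unlift ord0 i is Some j
             then if j == ord0 then inord (n ord0).-1 else n j
             else inord 1].

Lemma split_firstP m N (n : {ffun 'I_m.+1 -> 'I_N.+1}) :
  composition n -> n ord0 != 1%N :> nat ->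
  [/\ composition (split_first n), split_first n ord0 = 1%N :> nat
    & merge_first (split_first n) = n].
Proof.
case/andP=> /forallP n_gt0 /eqP; rewrite big_ord_recl => n_sum n0.
have N_gt0 := n_gt0 ord0; have := ltn_ord (n ord0) => n0N.
have E0 : split_first n ord0 = 1%N :> nat.
  by rewrite ffunE unlift_none inordK //; lia.
have E1 : split_first n (lift ord0 ord0) = (n ord0).-1 :> nat.
  by rewrite ffunE liftK eqxx inordK //; lia.
have E2 i : split_first n (lift ord0 (lift ord0 i)) = n (lift ord0 i).
  by rewrite ffunE liftK.
split=> //.
  apply/andP; split.
    apply/forallP => i; case: (unliftP ord0 i) => [j|] ->; last by rewrite E0.
    case: (unliftP ord0 j) => [l|] ->; first by rewrite E2.
    by rewrite E1; lia.
  rewrite 2!big_ord_recl E0 E1 (eq_bigr (fun i => n (lift ord0 i) : nat)).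
    by rewrite addnA add1n prednK // n_sum.
  by move=> i _; rewrite E2.
apply/ffunP => i; rewrite ffunE; case: (unliftP ord0 i) => [j|] ->; first by rewrite E2.
by apply: val_inj; rewrite /= E1 inordK; lia.
Qed.

Lemma merge_firstP m N (n : {ffun 'I_m.+2 -> 'I_N.+1}) :
  composition n -> n ord0 = 1%N :> nat ->
  [/\ composition (merge_first n),
      merge_first n ord0 = (n (lift ord0 ord0)).+1 :> nat
    & split_first (merge_first n) = n].
Proof.
case/andP=> /forallP n_gt0 /eqP; rewrite 2!big_ord_recl => n_sum n0.
rewrite n0 in n_sum.
have n1_gt0 := n_gt0 (lift ord0 ord0).
(* [inord] does not default here: the first two parts, 1 and the second, sum to at most [N]. *)
have E0 : merge_first n ord0 = (n (lift ord0 ord0)).+1 :> nat.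
  by rewrite ffunE unlift_none inordK //; move: n_sum; rewrite /=; lia.
have E1 i : merge_first n (lift ord0 i) = n (lift ord0 (lift ord0 i)).
  by rewrite ffunE liftK.
split=> //.
  apply/andP; split.
    by apply/forallP => i; case: (unliftP ord0 i) => [j|] ->; rewrite ?E0 ?E1.
  rewrite big_ord_recl E0 (eq_bigr (fun i => n (lift ord0 (lift ord0 i)) : nat)).
    by rewrite -[X in _ == X]n_sum addnA.
  by move=> i _; rewrite E1.
apply/ffunP => i; rewrite ffunE; case: (unliftP ord0 i) => [j|] ->.
  case: (unliftP ord0 j) => [l|] ->; first by rewrite E1.
  by apply: val_inj; rewrite /= E0 inordK //=; apply: ltn_ord.
by apply: val_inj; rewrite /= inordK //; have := ltn_ord (n (lift ord0 ord0)); lia.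
Qed.

Lemma sum_merge_first P' P m N (T : ltree N) : prel_mergeable P' P ->
  \sum_(n : {ffun 'I_m.+1 -> 'I_N.+1} | composition n && (n ord0 != 1%N :> nat))
     (comp_iso (ptree P' m.+1) (fun i => ptree P (n i)) T)%:R =
  \sum_(n : {ffun 'I_m.+2 -> 'I_N.+1} | composition n && (n ord0 == 1%N :> nat))
     (comp_iso (ptree P' m.+2) (fun i => ptree P (n i)) T)%:R :> rat.
Proof.
move=> H; rewrite (reindex_onto (@merge_first m N) (@split_first m N)) /=; last first.
  by move=> n /andP[nc n0]; have [] := split_firstP nc n0.
(* The side condition that splitting undoes merging on [n] is what forces [n] to begin with 1. *)
apply: eq_big => [n|n /andP[/andP[nc n0] /eqP nK]].
  apply/andP/andP => [[/andP[nc n0] /eqP <-]|[nc /eqP n0]].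
    by have [-> -> _] := split_firstP nc n0.
  have [-> -> ->] := merge_firstP nc n0; rewrite eqxx eqSS -lt0n.
  by case/andP: nc => /forallP ->.
have [nc' n0' _] := split_firstP nc n0; rewrite nK in nc' n0'.
have [_ E0 _] := merge_firstP nc' n0'.
pose n' k : nat := n (inord k).
have n'E i : n i = n' i :> nat by rewrite /n' inord_val.
rewrite (comp_iso_merge (n := fun i => n i) (n' := n')) //.
- by rewrite -n0' n'E.
- by case/andP: nc' => /forallP + _; apply.
- move=> i; case: (unliftP ord0 i) => [j|] ->; first by rewrite ffunE liftK n'E.
  by rewrite E0 n'E.
Qed.

(** * The telescoping sum *)

Lemma alternating_sum_compositions P' P N (T : ltree N) :
  (0 < N)%N -> prel_mergeable P' P ->
  \sum_(m < N.+1) (-1) ^+ m * \sum_(n : {ffun 'I_m -> 'I_N.+1} | composition n)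
     (comp_iso (ptree P' m) (fun i => ptree P (n i)) T)%:R =
  - (N == 1%N)%:R :> rat.
Proof.
move=> N_gt0 H.
pose Z m := \sum_(n : {ffun 'I_m -> 'I_N.+1} | composition n)
     (comp_iso (ptree P' m) (fun i => ptree P (n i)) T)%:R : rat.
pose A m := \sum_(n : {ffun 'I_m.+1 -> 'I_N.+1} | composition n && (n ord0 == 1%N :> nat))
     (comp_iso (ptree P' m.+1) (fun i => ptree P (n i)) T)%:R : rat.
have Z0 : Z 0%N = 0.
  rewrite /Z big_pred0 // => n; rewrite /composition big_ord0 andbC.
  by rewrite eq_sym (gtn_eqF N_gt0).
(* Compositions into [m + 1] parts that begin with 1 give [A m]; the others, by unmerging their
   first part, give [A m.+1]. *)
have ZS m : Z m.+1 = A m + A m.+1.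
  by rewrite /Z (bigID (fun n : {ffun 'I_m.+1 -> 'I_N.+1} => n ord0 == 1%N :> nat)) /=
     (sum_merge_first _ _ H).
(* [N + 1] positive parts cannot sum to [N]. *)
have AN : A N = 0.
  rewrite /A big_pred0 // => n; apply/negP => /andP[/andP[/forallP n_gt0 /eqP nN] _].
  suff : (\sum_(i < N.+1) 1 <= \sum_i n i)%N by rewrite sum1_card card_ord nN ltnn.
  exact: leq_sum.
have A0 : A 0%N = (N == 1%N)%:R.
  have [N1|N1] := eqVneq N 1%N; last first.
    rewrite /A big_pred0 // => n; apply/negP => /andP[/andP[_]].
    by rewrite big_ord_recl big_ord0 addn0 => /eqP -> /eqP; apply/eqP.
  subst N; rewrite /A (big_pred1 [ffun=> inord 1]) => [|n]; last first.
    rewrite /composition big_ord_recl big_ord0 addn0 -andbA andbb.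
    apply/andP/eqP => [[_ /eqP n0]|->].
      by apply/ffunP => i; rewrite ffunE (ord1 i); apply: ord_inj; rewrite n0 inordK.
    by rewrite ffunE inordK //; split=> //; apply/forallP => i; rewrite ffunE inordK.
  set b := comp_iso _ _ _; suff -> : b by [].
  have nE (i : 'I_1) : [ffun=> inord 1 : 'I_2] i = (fun=> 1%N) i :> nat.
    by rewrite ffunE inordK.
  apply/(@comp_iso_ptreeP P' P 1 _ (fun=> 1%N) _ T nE).
  exists (fun=> (0, 0)%N); split=> [u v _|//|v]; first by rewrite !ord1.
  (* On one vertex the junk value makes 0 its own parent for every [Q]. *)
  have par0 (Q : nat -> nat) : (if Q 0 < 1 then Q 0 else 0)%N = 0%N by case: (Q 0%N).
  by rewrite /prel /= !par0.
suff sumE k : \sum_(m < k.+1) (-1) ^+ m * Z m = (-1) ^+ k * A k - A 0%N.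
  by rewrite sumE AN A0 mulr0 add0r.
elim: k => [|k IHk]; first by rewrite big_ord1 Z0 mulr0 mul1r subrr.
rewrite big_ord_recr IHk /= ZS mulrDr exprS mulN1r !mulNr.
by rewrite addrAC addrA subrr add0r.
Qed.

(* C = L^{-1} in G_NAP: both products are the identity, coefficientwise on
   every (labelled representative of an unlabelled) rooted tree. *)
Theorem theorem6p14 :
  forall (N : nat) (T : ltree N), is_rtree T ->
    nap_mul Lser Cser N T = one_series N T /\ nap_mul Cser Lser N T = one_series N T.
Proof.
move=> N T Tr.
have N_gt0 : (0 < N)%N by case/existsP: Tr => -[r rN] _; apply: leq_ltn_trans rN.
rewrite /one_series Tr /=; split.
  rewrite (nap_mul_ptree Tr is_rtree_path is_rtree_corolla Lser_liso Cser_liso).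
  transitivity (- - (N == 1%N)%:R : rat); last by rewrite opprK; case: eqP.
  rewrite -(alternating_sum_compositions T N_gt0 prel_merge_path_corollas).
  (* The path with [m] vertices has sign [(-1) ^+ m.-1], opposite to [(-1) ^+ m] except at [m = 0],
     where there is no composition. *)
  rewrite -sumrN; apply: eq_bigr => -[[|m] mN] _.
    rewrite /= !big_pred0 ?mulr0 ?oppr0 // => n; rewrite /composition big_ord0 andbC;
    by rewrite eq_sym (gtn_eqF N_gt0).
  rewrite exprS mulN1r mulNr opprK; congr (_ * _).
  by apply: eq_bigr => n _; rewrite big1 ?mul1r.
rewrite (nap_mul_ptree Tr is_rtree_corolla is_rtree_path Cser_liso Lser_liso).
(* The paths contribute signs [(-1) ^+ (n i).-1] with product [(-1) ^+ (N - m)], that is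
   [(-1) ^+ N * (-1) ^+ m]; the factor [(-1) ^+ N] comes out of the sum and equals -1 in the
   surviving case [N = 1]. *)
transitivity ((-1) ^+ N * - (N == 1%N)%:R : rat); last first.
  by case: eqP => [->|_]; rewrite ?mulrNN ?mulr1 // oppr0 mulr0.
rewrite -(alternating_sum_compositions T N_gt0 prel_merge_corolla_paths).
rewrite mulr_sumr; apply: eq_bigr => m _; rewrite mul1r mulrA mulr_sumr.
apply: eq_bigr => n /andP[/forallP n_gt0 /eqP nN]; congr (_ * _).
rewrite -[in (-1) ^+ N]nN -prodrXr -[in (-1) ^+ m](card_ord m) -prodr_const -big_split /=.
by apply: eq_bigr => i _; rewrite -[in RHS](prednK (n_gt0 i)) exprSr -mulrA mulrNN !mulr1.
Qed.
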